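(* Let $\alpha_{0}=\sqrt[3]{\frac{27+\sqrt{741}}{486}}+\sqrt[3]{\frac{27-\sqrt{741}}{486}}$. Let $\alpha$ be a real number with $\alpha>\alpha_{0}$ and put $N=N(\alpha)=\frac{54}{9\alpha^{3}+\alpha-1}$. Then for every odd integer $n>N$ and every subset $\mathcal{A}\subseteq\mathbb{Z}_{n}$ with $|\mathcal{A}|\geq\alpha n$, one has $4^{\wedge}\mathcal{A}=\mathbb{Z}_{n}$.
   Context: $\mathbb{Z}_n$ denotes the additive cyclic group of integers modulo $n$. Cube roots are real cube roots. For a positive integer $h\ge 2$ and a subset $\mathcal{A}$ of $\mathbb{Z}_n$, $h^{\wedge}\mathcal{A}$ denotes the set of elements of $\mathbb{Z}_n$ that can be written as a sum of $h$ pairwise distinct elements of $\mathcal{A}$. *)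

(* Defs.v *)
From HB Require Import structures.
From mathcomp Require Import all_boot all_order all_algebra.
From mathcomp Require Import reals exp.

Set Implicit Arguments.
Unset Strict Implicit.
Unset Printing Implicit Defensive.

Import Order.TTheory GRing.Theory Num.Theory.

Local Open Scope ring_scope.

(* [powR] is only meaningful on nonnegative bases; the sign is needed because
   the real cube root is also applied to the negative number 27 - sqrt 741. *)
Definition cbrt (R : realType) (x : R) : R := Num.sg x * (`|x| `^ (3^-1)).

Definition alpha0 (R : realType) : R :=
  cbrt ((27 + Num.sqrt 741) / 486) + cbrt ((27 - Num.sqrt 741) / 486).

Definition threshold (R : realType) (alpha : R) : R :=
  54 / (9 * alpha ^+ 3 + alpha - 1).

Definition restricted_sumset (G : finZmodType) (h : nat) (A : {set G}) :
    {set G} :=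
  [set x | [exists t : h.-tuple G,
    [&& uniq t, all (mem A) t & x == \sum_(a <- t) a]]].

(* Main.v *)
Require Import Defs.
From HB Require Import structures.
From mathcomp Require Import all_boot all_order all_algebra all_field.
From mathcomp Require Import reals exp ring lra zify.

Set Implicit Arguments.
Unset Strict Implicit.
Unset Printing Implicit Defensive.

Import Order.TTheory GRing.Theory Num.Theory.

Local Open Scope ring_scope.

(** Write N for the odd modulus and a for #|A|. The number r of solutions of
    x = a1 + a2 + a3 + a4 with all a_i in A, repetitions allowed, satisfies
      N r = a^4 + sum over the nontrivial characters chi of F(chi)^4 chi(-x),
    where F(chi) is the sum of chi over A. Parseval gives
    N a - a^2 for the sum of |F(chi)|^2 over nontrivial chi, so everything
    hinges on a uniform bound for |F(chi)|. For a nontrivial character of a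
    group of odd order N this bound is N / 3 ([norm_subsum_character]),
    attained when chi has order 3 and A is a coset of its kernel. Hence
      9 r >= a (9 a^3 / N + a N - N^2)     ([card_solutions_ge]).

    A solution with two equal entries is determined by two of its entries, in
    six possible ways, so at most 6 a^2 solutions are degenerate and r > 6 a^2
    suffices ([restricted_sumset4]). As a <= N, this follows from
    9 a^3 + a N^2 > N^3 + 54 N^2; with density a / N at least alpha it follows
    from N (9 alpha^3 + alpha - 1) > 54, which is the threshold condition.
    Finally alpha0 is the real root, given by Cardano's formula, of
    9 X^3 + X - 1 ([alpha0_root]), so that alpha > alpha0 makes the
    denominator of the threshold positive.

    The bound N / 3 needs no trigonometry. Rotate F(chi) to be nonnegative
    real: with |z| = 1 and w_a = z chi(a), |F(chi)| is half the sum over A of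
    the real numbers w_a + conj w_a, whose total over the group is 0. So
    4 |F(chi)| is at most the sum of s_a = |w_a + conj w_a| over the whole
    group. On [0, 2] the function s lies below an even quartic in s, and the
    average of s_a^2 and s_a^4 over the group is the same for every
    nontrivial character of odd order, because chi^2 and chi^4 are again
    nontrivial. The quartic is the one touching s at s = 1 and meeting it at
    s = 2, the two values that occur for a character of order 3 in extremal
    position. *)

(** * Partial sums of a character *)

Section Characters.
Variables (C : numClosedFieldType) (G : finZmodType).

Definition additive_character (chi : G -> C) :=
  chi 0 = 1 /\ {morph chi : a b / a + b >-> a * b}.

Lemma character_neq0 chi a : additive_character chi -> chi a != 0.
Proof.
move=> [chi0 chiD]; apply/eqP => chia.
move: chi0; rewrite -(subrr a) chiD chia mul0r => /esym/eqP.
by rewrite oner_eq0.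
Qed.

Lemma character_expX chi k :
  additive_character chi -> additive_character (fun a => chi a ^+ k).
Proof.
by move=> [chi0 chiD]; split=> [|a b]; rewrite ?chi0 ?expr1n // chiD exprMn.
Qed.

(** Translating the product of all values of [chi] by [a] multiplies it by
    [chi a] to the power of the order of the group. *)
Lemma character_card chi a : additive_character chi -> chi a ^+ #|G| = 1.
Proof.
move=> chiP; have [_ chiD] := chiP.
have prod_neq0 : \prod_b chi b != 0.
  by apply/prodf_neq0 => b _; apply: character_neq0.
apply: (mulIf prod_neq0); rewrite mul1r -prodr_const -big_split /=.
by rewrite [RHS](reindex_inj (addrI a)) /=; apply: eq_bigr => b _; rewrite chiD.
Qed.

Lemma character_norm chi a : additive_character chi -> `|chi a| = 1.
Proof.
move=> chiP; apply/eqP; rewrite -(@pexpr_eq1 _ _ #|G|) //; last first.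
  by apply/card_gt0P; exists 0.
by rewrite -normrX character_card ?normr1.
Qed.

Lemma character_conj chi a : additive_character chi -> (chi a)^* = chi (- a).
Proof.
move=> chiP; have [chi0 chiD] := chiP.
apply: (mulfI (character_neq0 a chiP)).
by rewrite -normCK character_norm // expr1n -chiD subrr chi0.
Qed.

Lemma sum_character chi g :
  additive_character chi -> chi g != 1 -> \sum_a chi a = 0.
Proof.
move=> [_ chiD] chig.
suff /eqP : (chi g - 1) * \sum_a chi a = 0.
  by rewrite mulf_eq0 subr_eq0 (negPf chig) => /eqP.
rewrite mulrBl mul1r mulr_sumr; apply/eqP; rewrite subr_eq0; apply/eqP.
rewrite [RHS](reindex_inj (addrI g)) /=.
by apply: eq_bigr => a _; rewrite chiD.
Qed.

Lemma odd_sqr_eq1 (x : C) m : odd m -> x ^+ m = 1 -> (x ^+ 2 == 1) = (x == 1).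
Proof.
move=> odd_m xm; apply/eqP/eqP=> [x2|->]; last by rewrite expr1n.
by rewrite -xm -(odd_double_half m) odd_m exprD -mul2n exprM x2 expr1n mulr1.
Qed.

(** The majorant touches [s] at 1 and meets it at 2, the values of
    |w + conj w| at the three cube roots of unity w; this is what makes the
    constant 1 / 3 below sharp. *)
Lemma norm_le_quartic (s : C) :
  0 <= s -> s <= 2 -> s <= 2^-1 + s ^+ 2 / 2 - (s ^+ 2 - 1) ^+ 2 / 18.
Proof.
move=> s_ge0 s_le2; rewrite -subr_ge0.
have -> : 2^-1 + s ^+ 2 / 2 - (s ^+ 2 - 1) ^+ 2 / 18 - s
          = (s - 1) ^+ 2 * ((2 - s) * (s + 4)) / 18 by field.
apply: divr_ge0 => //; apply: mulr_ge0.
  by rewrite real_exprn_even_ge0 // rpredB ?ger0_real.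
by apply: mulr_ge0; rewrite ?subr_ge0 ?addr_ge0.
Qed.

(** A sum of a zero-sum real family over part of its index set is at most half
    the sum of its absolute values; the quartic majorant turns the latter into
    power sums of characters, of which only the constant terms survive. Odd
    order enters only to keep [chi] squared and [chi] to the fourth
    nontrivial. *)
Lemma norm_subsum_character chi g (A : {set G}) :
    odd #|G| -> additive_character chi -> chi g != 1 ->
  `|\sum_(a in A) chi a| <= #|G|%:R / 3.
Proof.
move=> oddG chiP chig; set S := \sum_(a in A) _.
have [->|S_neq0] := eqVneq S 0; first by rewrite normr0 divr_ge0 ?ler0n.
pose z := `|S| / S.
have norm_z : `|z| = 1 by rewrite normf_div normr_id divff ?normr_eq0.
have zS : z * S = `|S| by rewrite mulfVK.
pose w a := z * chi a.
have norm_w a : `|w a| = 1 by rewrite normrM norm_z mul1r character_norm.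
have ww a : w a * (w a)^* = 1 by rewrite -normCK norm_w expr1n.
have sum_w k h : chi h ^+ k != 1 -> \sum_a w a ^+ k = 0.
  move=> chih; under eq_bigr do rewrite exprMn.
  by rewrite -mulr_sumr (sum_character (character_expX k chiP) chih) mulr0.
have sum_wC k h : chi h ^+ k != 1 -> \sum_a (w a)^* ^+ k = 0.
  move=> chih; under eq_bigr do rewrite -rmorphXn.
  by rewrite -rmorph_sum /= (sum_w _ _ chih) conjC0.
have chig2 : chi g ^+ 2 != 1.
  by rewrite (odd_sqr_eq1 oddG) ?character_card.
have chig4 : chi g ^+ 4 != 1.
  rewrite (exprM _ 2 2) (odd_sqr_eq1 oddG) //.
  by rewrite exprAC character_card ?expr1n.
pose t a := w a + (w a)^*.
have t_sum0 : \sum_a t a = 0.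
  by rewrite big_split /= (sum_w 1%N g chig) (sum_wC 1%N g chig) addr0.
have t_sumA : \sum_(a in A) t a = `|S| *+ 2.
  rewrite big_split /= -rmorph_sum /= -mulr_sumr -/S zS.
  by rewrite (@conj_Creal _ `|S|) ?normr_real ?mulr2n.
have t_sumAC : \sum_(a | a \notin A) t a = - (`|S| *+ 2).
  apply/eqP; rewrite -addr_eq0 addrC -t_sumA.
  by move: t_sum0; rewrite (bigID (mem A)) /= => ->.
have t_real a : t a \is Num.real by rewrite CrealE rmorphD /= conjCK addrC.
have t_le2 a : `|t a| <= 2.
  by rewrite (le_trans (ler_normD _ _)) // norm_conjC norm_w.
have S4 : `|S| * 4 <= \sum_a `|t a|.
  rewrite (_ : _ * 4 = `|\sum_(a in A) t a| + `|\sum_(a | a \notin A) t a|).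
    by rewrite [X in _ <= X](bigID (mem A)) /= lerD ?ler_norm_sum.
  rewrite t_sumA t_sumAC normrN normrMn normr_id.
  by ring.
have sum_t : \sum_a `|t a| <= #|G|%:R * (4 / 3).
  have t_quartic a := norm_le_quartic (normr_ge0 _) (t_le2 a).
  apply: le_trans (ler_sum _ (fun a _ => t_quartic a)) _.
  (* Since w_a is unimodular, the majorant is a combination of the second and
     fourth powers of w_a and its conjugate, with average 4 / 3. *)
  have E a : 2^-1 + `|t a| ^+ 2 / 2 - (`|t a| ^+ 2 - 1) ^+ 2 / 18 =
     4 / 3 + 7 / 18 * (w a ^+ 2 + (w a)^* ^+ 2)
     - 1 / 18 * (w a ^+ 4 + (w a)^* ^+ 4).
    rewrite real_normK // /t.
    have := ww a; move: (w a) (w a)^* => u v uv.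
    have -> : (u + v) ^+ 2 = u ^+ 2 + v ^+ 2 + 2 * (u * v) by ring.
    rewrite uv.
    have -> : (u ^+ 2 + v ^+ 2 + 2 * 1 - 1) ^+ 2 =
      u ^+ 4 + v ^+ 4 + 2 * (u * v) ^+ 2 + 2 * (u ^+ 2 + v ^+ 2) + 1 by ring.
    by rewrite uv; field.
  rewrite (eq_bigr _ (fun a _ => E a)) big_split sumrN big_split /= -!mulr_sumr.
  rewrite !big_split /= (sum_w _ _ chig2) (sum_wC _ _ chig2).
  rewrite (sum_w _ _ chig4) (sum_wC _ _ chig4) !addr0 !mulr0 subr0 addr0.
  by rewrite sumr_const -[3^-1 *+ _]mulr_natl mulrCA lexx.
have lt04 : 0 < 4 :> C by rewrite ltr0n.
rewrite -(ler_pM2r lt04) (le_trans S4) // (le_trans sum_t) //.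
by rewrite mulrA mulrAC lexx.
Qed.

End Characters.

(** * Solutions with repeated entries *)

Lemma card_bigcup_imset_le (S T : finType) (D : {set S}) (fs : seq (S -> T)) :
  (#|\bigcup_(f <- fs) f @: D| <= size fs * #|D|)%N.
Proof.
elim: fs => [|f fs IHfs]; first by rewrite big_nil cards0.
rewrite big_cons (leq_trans (leq_card_setU _ _)) // mulSn leq_add //.
exact: leq_imset_card.
Qed.

(** Four-term representations of [x] are encoded by their first three entries,
    the fourth one being forced. *)
Definition solutions (G : finZmodType) (A : {set G}) (x : G) :
    {set G * G * G} :=
  [set t in setX (setX A A) A | x - t.1.1 - t.1.2 - t.2 \in A].

(** For each of the six pairs of entries that may coincide, the degenerate
    solutions are parametrised by two entries taken from [A]; these six images
    cannot cover all solutions. The two parameters are always chosen so that no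
    division by 2 is needed to recover the others. *)
Lemma restricted_sumset4 (G : finZmodType) (A : {set G}) (x : G) :
  (6 * #|A| ^ 2 < #|solutions A x|)%N -> x \in restricted_sumset 4 A.
Proof.
pose fs : seq (G * G -> G * G * G) :=
  [:: fun p => (p.1, p.1, p.2);
      fun p => (p.1, p.2, p.1);
      fun p => (p.1, p.2, p.2);
      fun p => (p.1, p.2, x - p.1 - p.1 - p.2);
      fun p => (p.1, p.2, x - p.1 - p.2 - p.2);
      fun p => (p.1, x - p.1 - p.2 - p.2, p.2)].
move=> many.
have /subsetPn[[[a b] c]] :
    ~~ (solutions A x \subset \bigcup_(f <- fs) f @: setX A A).
  apply: contraL many => /subset_leq_card sub; rewrite -leqNgt.
  by rewrite (leq_trans sub) // (leq_trans (card_bigcup_imset_le _ _)) // cardsX.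
rewrite inE !in_setX /= => /andP[/andP[/andP[aA bA] cA] dA].
set d := x - a - b - c in dA *.
have cE : c = x - a - b - d by rewrite /d subKr.
have bE : b = x - a - c - d by rewrite /d [_ - b - c]addrAC subKr.
have dE : a + b + c + d = x.
  have -> : d = x - (a + b + c) by rewrite !opprD !addrA.
  by rewrite addrC subrK.
rewrite /fs !big_cons big_nil !inE !negb_or andbT.
case/and5P => ab ac bc ad /andP[bd cd].
have img f u v : u \in A -> v \in A -> (a, b, c) = f (u, v) ->
    (a, b, c) \in [set f p | p in setX A A].
  by move=> uA vA ->; apply: imset_f; rewrite in_setX uA vA.
apply/existsP; exists [tuple a; b; c; d].
rewrite /= aA bA cA dA !big_cons big_nil addr0 !inE !negb_or /=.
have -> : x == a + (b + (c + d)) by rewrite -dE !addrA.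
rewrite !andbT; apply/and3P; split; first (apply/and3P; split).
- by apply: contraNneq ab => e; apply: (img _ a c); rewrite // e.
- by apply: contraNneq ac => e; apply: (img _ a b); rewrite // e.
- apply: contraNneq ad => e; apply: (img _ a b); rewrite //=.
  by congr (_, _); rewrite {1}cE addrAC -e.
- apply/andP; split.
    by apply: contraNneq bc => e; apply: (img _ a b); rewrite // e.
  apply: contraNneq bd => e; apply: (img _ a b); rewrite //=.
  by congr (_, _); rewrite {1}cE -e.
- apply: contraNneq cd => e; apply: (img _ a c); rewrite //=.
  by congr (_, _, _); rewrite {1}bE -e.
Qed.


(** * Fourier analysis on the integers modulo n + 1 *)

Lemma sum_setX_mul (C : comPzRingType) (S T : finType)
    (A : {set S}) (B : {set T}) (f : S -> C) (g : T -> C) :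
  \sum_(p in setX A B) f p.1 * g p.2 =
  (\sum_(a in A) f a) * (\sum_(b in B) g b).
Proof.
rewrite big_distrlr pair_big /=.
by apply: eq_bigl => -[a b]; rewrite in_setX.
Qed.

Section Fourier.
Variables (C : numClosedFieldType) (n : nat) (omega : C).
Hypothesis omegaP : n.+1.-primitive_root omega.
Implicit Types (A : {set 'I_n.+1}) (j a x : 'I_n.+1).

Definition zchar j a : C := omega ^+ (j * a).

Lemma zchar_additive j : additive_character (zchar j).
Proof.
split=> [|a b]; rewrite /zchar ?muln0 // -exprD -mulnDr /=.
by rewrite -(prim_expr_mod omegaP) modnMmr (prim_expr_mod omegaP).
Qed.

Lemma zchar0 a : zchar 0 a = 1.
Proof. by rewrite /zchar mul0n. Qed.

(** The test point is [inord 1] since the trivial group carries no ring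
    structure with a 1; a nonzero [j] rules that group out. *)
Lemma zchar_neq1 j : j != 0 -> zchar j (inord 1) != 1.
Proof.
rewrite -val_eqE /= -lt0n => j_gt0.
have n_gt0 : (0 < n)%N by rewrite -ltnS (leq_trans _ (ltn_ord j)).
rewrite /zchar inordK ?ltnS // muln1 -(prim_order_dvd omegaP).
by apply/negP => /dvdn_leq - /(_ j_gt0); rewrite leqNgt ltn_ord.
Qed.

(** [zchar] is symmetric in its two arguments, so orthogonality over the dual
    group is the vanishing of the sum of the character indexed by [a]. *)
Lemma sum_zchar a : \sum_j zchar j a = n.+1%:R * (a == 0)%:R.
Proof.
under eq_bigr do rewrite /zchar mulnC.
have [->|a_neq0] := eqVneq a 0.
  by under eq_bigr do rewrite mul0n; rewrite sumr_const card_ord mulr1.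
by rewrite (sum_character (zchar_additive a) (zchar_neq1 a_neq0)) mulr0.
Qed.

Definition fourier A j : C := \sum_(a in A) zchar j a.

Lemma fourier0 A : fourier A 0 = #|A|%:R.
Proof.
rewrite /fourier; under eq_bigr do rewrite zchar0.
by rewrite sumr_const.
Qed.

Lemma fourier_inversion A x :
  \sum_j fourier A j * zchar j (- x) = n.+1%:R * (x \in A)%:R.
Proof.
under eq_bigr do rewrite mulr_suml.
rewrite exchange_big /=.
have E a : \sum_j zchar j a * zchar j (- x) = n.+1%:R * (a == x)%:R.
  rewrite -(subr_eq0 a) -sum_zchar; apply: eq_bigr => j _.
  by have [_ ->] := zchar_additive j.
rewrite (eq_bigr _ (fun a _ => E a)) -mulr_sumr; congr (_ * _).
have [xA|xNA] := boolP (x \in A).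
  rewrite (bigD1 x) //= eqxx big1 ?addr0 // => a /andP[_ /negPf->] //.
by rewrite big1 // => a aA; case: eqP aA xNA => // -> ->.
Qed.

(** The conjugate of a Fourier coefficient is a sum of values at opposite
    points, so this is the inversion formula summed over [A]. *)
Lemma parseval A : \sum_j `|fourier A j| ^+ 2 = n.+1%:R * #|A|%:R.
Proof.
have E j : `|fourier A j| ^+ 2 = \sum_(a in A) fourier A j * zchar j (- a).
  rewrite normCK -mulr_sumr; congr (_ * _); rewrite rmorph_sum.
  by apply: eq_bigr => a _; apply: character_conj; apply: zchar_additive.
rewrite (eq_bigr _ (fun j _ => E j)) exchange_big /=.
under eq_bigr => a aA do rewrite fourier_inversion aA mulr1.
by rewrite sumr_const mulr_natr.
Qed.

(** Fourier inversion replaces the membership of the fourth entry by a sum over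
    characters, after which the other three entries are independent. *)
Lemma card_solutions A x :
  n.+1%:R * #|solutions A x|%:R = \sum_j fourier A j ^+ 4 * zchar j (- x).
Proof.
rewrite -sum1_card natr_sum mulr_sumr.
under eq_bigl do rewrite inE.
rewrite big_mkcondr /=.
under eq_bigr => t _.
  rewrite -(_ : n.+1%:R * (x - t.1.1 - t.1.2 - t.2 \in A)%:R = if _ then _ else _).
    by rewrite -fourier_inversion; over.
  by case: ifP; rewrite ?mulr1 ?mulr0.
rewrite exchange_big /=; apply: eq_bigr => j _.
have [_ zD] := zchar_additive j.
rewrite -mulr_sumr exprS -mulrA; congr (_ * _).
rewrite !exprS expr0 mulr1 mulrA -!sum_setX_mul mulr_suml.
by apply: eq_bigr => t _; rewrite !opprD !opprK !zD; ring.
Qed.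

(** The trivial character gives the main term. In each other term, two of the
    four factors are bounded by the uniform estimate of
    [norm_subsum_character], and the other two are summed by Parseval. *)
Lemma card_solutions_ge A x : odd n.+1 ->
  #|A|%:R ^+ 4 - n.+1%:R ^+ 2 / 9 * (n.+1%:R * #|A|%:R - #|A|%:R ^+ 2)
    <= n.+1%:R * #|solutions A x|%:R :> C.
Proof.
move=> odd_n; rewrite card_solutions (bigD1 0) //= fourier0.
rewrite zchar0 mulr1 lerD2l; set Z := \sum_(j | _) _.
have Z_real : Z \is Num.real.
  have -> : Z = n.+1%:R * #|solutions A x|%:R - #|A|%:R ^+ 4.
    rewrite card_solutions (bigD1 0) //= fourier0.
    by rewrite zchar0 mulr1 [X in X - _]addrC addrK.
  by rewrite rpredB ?rpredM ?rpredX ?realn.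
suff : `|Z| <= n.+1%:R ^+ 2 / 9 * (n.+1%:R * #|A|%:R - #|A|%:R ^+ 2).
  by rewrite real_ler_norml // => /andP[].
have -> : n.+1%:R * #|A|%:R - #|A|%:R ^+ 2
          = \sum_(j | j != 0) `|fourier A j| ^+ 2 :> C.
  by rewrite -parseval (bigD1 0) //= fourier0 normr_nat [X in X - _]addrC addrK.
rewrite mulr_sumr (le_trans (ler_norm_sum _ _ _)) // ler_sum // => j j_neq0.
rewrite normrM (character_norm _ (zchar_additive j)) mulr1 normrX (exprD _ 2 2).
rewrite ler_wpM2r ?exprn_ge0 //.
have -> : n.+1%:R ^+ 2 / 9 = (n.+1%:R / 3) ^+ 2 :> C by field.
rewrite lerXn2r ?nnegrE ?divr_ge0 ?ler0n //.
rewrite -[X in X%:R]card_ord.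
apply: norm_subsum_character (zchar_neq1 j_neq0); first by rewrite card_ord.
exact: zchar_additive.
Qed.

End Fourier.

(** The lower bound for the number of solutions exceeds 6 times the square of
    the size of [A], since that size is at most the modulus. *)
Lemma restricted_sumset4_full (n : nat) (A : {set 'I_n.+1}) : odd n.+1 ->
    (n.+1 ^ 3 + 54 * n.+1 ^ 2 < 9 * #|A| ^ 3 + #|A| * n.+1 ^ 2)%N ->
  restricted_sumset 4 A = [set: 'I_n.+1].
Proof.
move=> odd_n big_A; apply/setP => x; rewrite [RHS]inE; apply: restricted_sumset4.
have [omega omegaP] := C_prim_root_exists (ltn0Sn n).
have := card_solutions_ge omegaP A x odd_n.
have leAn : (#|A| <= n.+1)%N by have := max_card A; rewrite card_ord.
move: big_A leAn; set a := #|A|; set N := n.+1; set r := #|_| => big_A leAN.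
have A_gt0 : (0 < a)%N by rewrite lt0n; apply: contraTneq big_A => ->; nia.
have E : a%:R ^+ 4 - N%:R ^+ 2 / 9 * (N%:R * a%:R - a%:R ^+ 2) =
   (a * (9 * a ^ 3 + a * N ^ 2))%:R / 9 - (a * N ^ 3)%:R / 9 :> algC.
  by rewrite !(natrM, natrD, natrX); field.
rewrite E lerBlDr -(ler_pM2r (_ : 0 < 9 :> algC)) ?ltr0n //.
rewrite mulfVK ?pnatr_eq0 // mulrDl mulfVK ?pnatr_eq0 //.
rewrite -!(natrM, natrD) ler_nat; nia.
Qed.

(** * The density threshold *)

Lemma cbrtX3 (R : realType) (x : R) : cbrt x ^+ 3 = x.
Proof.
rewrite /cbrt exprMn -[X in _ * X](powR_mulrn _ (powR_ge0 _ _)) -powRrM.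
rewrite mulVf ?pnatr_eq0 // powRr1 ?normr_ge0 //.
rewrite exprS sqr_sg; have [->|x0] := eqVneq x 0.
  by rewrite normr0 mulr0.
by rewrite mulr1 -numEsg.
Qed.

(** With u and v the two cube roots, u^3 + v^3 = 1 / 9 and u v = - 1 / 27, so
    the expansion of (u + v)^3 is the equation of the cubic. *)
Lemma alpha0_root (R : realType) : 9 * alpha0 R ^+ 3 + alpha0 R - 1 = 0.
Proof.
rewrite /alpha0; set s := Num.sqrt 741.
have s2 : s ^+ 2 = 741 by rewrite sqr_sqrtr ?ler0n.
have := cbrtX3 ((27 - s) / 486); have := cbrtX3 ((27 + s) / 486).
move: (cbrt ((27 + s) / 486)) (cbrt ((27 - s) / 486)) => u v u3 v3.
have uv : u * v = - 27^-1.
  have uv3 : (u * v) ^+ 3 = - 27^-1 ^+ 3.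
    rewrite exprMn u3 v3.
    have -> : (27 + s) / 486 * ((27 - s) / 486)
              = (27 ^+ 2 - s ^+ 2) / 486 ^+ 2 by field.
    by rewrite s2; field.
  (* The product is only known through its cube; the cofactor of p + 1 / 27
     in p^3 + 1 / 27^3 is a square plus a positive constant. *)
  move: (u * v) uv3 => p p3.
  have : (p + 27^-1) * ((p - 54^-1) ^+ 2 + 972^-1) = 0.
    have -> : (p + 27^-1) * ((p - 54^-1) ^+ 2 + 972^-1)
              = p ^+ 3 + 27^-1 ^+ 3 by field.
    by rewrite p3 addNr.
  move=> /eqP; rewrite mulf_eq0 => /orP[|/eqP].
    by rewrite addr_eq0 => /eqP.
  by have := sqr_ge0 (p - 54^-1); lra.
have -> : (u + v) ^+ 3 = u ^+ 3 + v ^+ 3 + 3 * (u * v) * (u + v) by ring.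
by rewrite u3 v3 uv; field.
Qed.

(** Multiplying the threshold inequality by N^2 and replacing alpha N by the
    larger [a] gives an inequality between natural numbers, free of the real
    field. *)
Lemma card_of_density (R : realType) (alpha : R) (N a : nat) :
    alpha0 R < alpha -> threshold alpha < N%:R -> alpha * N%:R <= a%:R ->
  (N ^ 3 + 54 * N ^ 2 < 9 * a ^ 3 + a * N ^ 2)%N.
Proof.
move=> alpha_gt; have root := alpha0_root R.
have alpha0_gt0 : 0 < alpha0 R.
  rewrite ltNge; apply/negP => le0.
  have := mulr_le0_ge0 le0 (sqr_ge0 (alpha0 R)); rewrite -exprS; lra.
have alpha_gt0 : 0 < alpha := lt_trans alpha0_gt0 alpha_gt.
have f_gt0 : 0 < 9 * alpha ^+ 3 + alpha - 1.
  have : alpha0 R ^+ 3 <= alpha ^+ 3 by apply: lerXn2r; rewrite ?nnegrE ltW.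
  lra.
rewrite /threshold ltr_pdivrMr // => N_gt le_a.
have N_gt0 : 0 < N%:R :> R.
  rewrite ltNge; apply/negP => le0.
  by have := mulr_le0_ge0 le0 (ltW f_gt0); lra.
have a3 : (alpha * N%:R) ^+ 3 <= a%:R ^+ 3.
  by rewrite lerXn2r ?nnegrE ?mulr_ge0 ?ler0n // ltW.
have aN2 : alpha * N%:R * N%:R ^+ 2 <= a%:R * N%:R ^+ 2.
  by rewrite ler_wpM2r // exprn_ge0 ?ler0n.
have big : 54 * N%:R ^+ 2 < N%:R * (9 * alpha ^+ 3 + alpha - 1) * N%:R ^+ 2.
  by rewrite ltr_pM2r ?exprn_gt0.
rewrite -(ltr_nat R) !(natrD, natrM, natrX).
have -> : N%:R ^+ 3 = 9 * (alpha * N%:R) ^+ 3 + alpha * N%:R * N%:R ^+ 2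
   - N%:R * (9 * alpha ^+ 3 + alpha - 1) * N%:R ^+ 2 :> R by ring.
lra.
Qed.

(* The modulus is n.+1: the type 'I_n.+1 with its zmodType structure is the
   group of integers modulo n.+1 for every n, including the trivial group
   (whereas 'Z_1 would have two elements). *)
Theorem theorem1p4 (R : realType) (alpha : R) (halpha : alpha0 R < alpha)
    (n : nat) (hodd : odd n.+1) (hn : threshold alpha < n.+1%:R)
    (A : {set 'I_n.+1}) (hA : alpha * n.+1%:R <= #|A|%:R) :
  restricted_sumset 4 A = [set: 'I_n.+1].
Proof.
exact: restricted_sumset4_full hodd (card_of_density halpha hn hA).
Qed.
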